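(* For all $d\in\mathbb{N}$, all convex bodies $K\subset\mathbb{R}^d$ and all $\delta$ with $0<\delta\leq 8^{-d}$, the convex floating body $K_\delta$ is non-empty and $$d_{\mathfrak{L}}(K,K_\delta)\leq 1+8\delta^{1/d},\qquad d_{BM}(K,K_\delta)\leq 1+24\delta^{1/d}.$$
   Context: A convex body in $\mathbb{R}^d$ is a compact convex set with non-empty interior. For $\theta\in S^{d-1}$ (the Euclidean unit sphere) and $t\in\mathbb{R}$ let $\mathfrak{H}_{\theta,t}=\{x\in\mathbb{R}^d:\langle x,\theta\rangle\geq t\}$. For a convex body $K\subset\mathbb{R}^d$ and $\delta>0$, the convex floating body inside $K$ is $$K_\delta=\bigcap\{\mathfrak{H}_{\theta,t}:\theta\in S^{d-1},\ t\in\mathbb{R},\ \mathrm{vol}_d(\mathfrak{H}_{\theta,t}\cap K)\geq(1-\delta)\,\mathrm{vol}_d(K)\}.$$ The logarithmic Hausdorff distance between convex bodies $K,L\subset\mathbb{R}^d$ is $$d_{\mathfrak{L}}(K,L)=\inf\{\lambda\geq 1:\exists x\in \mathrm{int}(K\cap L),\ \lambda^{-1}(K-x)+x\subset L\subset\lambda(K-x)+x\}.$$ The Banach-Mazur distance between convex bodies $K,L\subset\mathbb{R}^d$ is $$d_{BM}(K,L)=\inf\{\lambda\geq 1:\exists x\in\mathbb{R}^d,\ \exists T,\ K\subset TL\subset\lambda(K-x)+x\},$$ where $T$ ranges over affine transformations of $\mathbb{R}^d$. *)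

(* Defs.v *)
From HB Require Import structures.
From mathcomp Require Import all_boot all_order all_algebra.
From mathcomp Require Import all_classical all_reals all_analysis.

Set Implicit Arguments.
Unset Strict Implicit.
Unset Printing Implicit Defensive.

Import Order.TTheory GRing.Theory Num.Theory.
Import numFieldNormedType.Exports.

Local Open Scope classical_set_scope.
Local Open Scope ring_scope.

Section lebesgue_tuple.
Context {R : realType}.
Local Notation mR := (measurableTypeR R).

Definition tcons n (p : mR * n.-tuple mR) : n.+1.-tuple mR :=
  [tuple of p.1 :: p.2].

Lemma measurable_tcons n : measurable_fun setT (@tcons n).
Proof. by apply: measurable_cons; [exact: measurable_fst|exact: measurable_snd]. Qed.

Section step.
Variables (n : nat) (m : {sigma_finite_measure set (n.-tuple mR) -> \bar R}).

Definition lebesgue_tcons : set (n.+1.-tuple mR) -> \bar R :=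
  pushforward (@lebesgue_measure R \x m)%E (@tcons n).

Let lebesgue_tcons0 : lebesgue_tcons set0 = 0%E.
Proof. by rewrite /lebesgue_tcons /pushforward preimage_set0 measure0. Qed.

Let lebesgue_tcons_ge0 A : (0 <= lebesgue_tcons A)%E.
Proof. by rewrite /lebesgue_tcons /pushforward measure_ge0. Qed.

Let lebesgue_tcons_sigma_additive : semi_sigma_additive lebesgue_tcons.
Proof.
have mtc A : measurable A -> measurable (@tcons n @^-1` A).
  by move=> mA; rewrite -[X in measurable X]setTI; exact: measurable_tcons.
move=> F mF tF mUF; rewrite /lebesgue_tcons /pushforward preimage_bigcup.
apply: measure_semi_sigma_additive.
- by move=> k; exact: mtc.
- apply/trivIsetP => i j _ _ ij; rewrite -preimage_setI.
  by move/trivIsetP : tF => /(_ _ _ _ _ ij) ->//; rewrite preimage_set0.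
- by rewrite -preimage_bigcup; exact: mtc.
Qed.

HB.instance Definition _ := isMeasure.Build _ _ _ lebesgue_tcons
  lebesgue_tcons0 lebesgue_tcons_ge0 lebesgue_tcons_sigma_additive.

Let lebesgue_tcons_sigma_finite : sigma_finite setT lebesgue_tcons.
Proof.
have /sigma_finiteP[F [TF ndF Foo]] := sigma_finiteT (@lebesgue_measure R).
have /sigma_finiteP[G [TG ndG Goo]] := sigma_finiteT m.
pose u (t : n.+1.-tuple mR) : mR * n.-tuple mR := (thead t, [tuple of behead t]).
have uK p : u (tcons p) = p by case: p => x t; congr pair; exact/val_inj.
have meas_u : measurable_fun setT u.
  apply: measurable_fun_pair; last exact: measurable_behead.
  exact: (measurable_tnth (ord0 : 'I_n.+1)).
exists (fun k => u @^-1` (F k `*` G k)).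
  rewrite -preimage_bigcup; apply/esym; rewrite -subTset => t _.
  have : setT (thead t) by [].
  rewrite TF => -[i _ Fi].
  have : setT [tuple of behead t] by [].
  rewrite TG => -[j _ Gj].
  exists (maxn i j) => //; split.
  - by have /subsetPset := ndF _ _ (leq_maxl i j); exact.
  - by have /subsetPset := ndG _ _ (leq_maxr i j); exact.
move=> k; have [mF Fk] := Foo k; have [mG Gk] := Goo k; split.
  by rewrite -[X in measurable X]setTI; apply: meas_u => //; exact: measurableX.
rewrite /lebesgue_tcons /pushforward (_ : _ @^-1` _ = F k `*` G k).
  by rewrite product_measure1E// lte_mul_pinfty// ge0_fin_numE.
by apply/seteqP; split => p; rewrite /preimage /mkset uK.
Qed.

HB.instance Definition _ :=
  Measure_isSigmaFinite.Build _ _ _ lebesgue_tcons lebesgue_tcons_sigma_finite.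

End step.

(* The [n]-fold product of the Lebesgue measure of the line; for [n = 0] it is
   the unit mass on the one-point space. *)
Fixpoint lebesgue_tuple n : {sigma_finite_measure set (n.-tuple mR) -> \bar R} :=
  match n with
  | 0 => \d_([tuple] : 0.-tuple mR)
  | n'.+1 => lebesgue_tcons (lebesgue_tuple n')
  end.

End lebesgue_tuple.

Section floating_body.
Context {R : realType} {d : nat}.
Implicit Types (K L : set 'rV[R]_d) (x y theta : 'rV[R]_d) (t l delta : R).

(* The library has no measurable structure on row vectors, so the measure of
   [A] is that of the corresponding set of tuples. *)
Definition vol (A : set 'rV[R]_d) : \bar R :=
  lebesgue_tuple d [set u : d.-tuple (measurableTypeR R) | A (\row_i tnth u i)].

Definition dotp x y : R := \sum_(i < d) x 0 i * y 0 i.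

(* The library norm on ['rV[R]_d] is the sup norm, so the Euclidean unit sphere
   is spelled out through the inner product; the topology is the usual one. *)
Definition unit_sphere : set 'rV[R]_d := [set x | Num.sqrt (dotp x x) = 1].

Definition halfspace theta t : set 'rV[R]_d := [set x | t <= dotp x theta].

Definition convex_body K : Prop :=
  [/\ compact K, convex_set (K : set (convex_lmodType 'rV[R]_d)) & K° !=set0].

Definition floating_body K delta : set 'rV[R]_d :=
  \bigcap_(p in [set p : 'rV[R]_d * R | unit_sphere p.1 /\
      ((1 - delta)%:E * vol K <= vol (halfspace p.1 p.2 `&` K))%E])
    halfspace p.1 p.2.

Definition homothety x l K : set 'rV[R]_d := [set l *: (y - x) + x | y in K].

Definition affine_transformation (T : 'rV[R]_d -> 'rV[R]_d) : Prop :=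
  exists (A : 'M[R]_d) (b : 'rV[R]_d),
    A \in unitmx /\ forall y, T y = y *m A + b.

(* Both distances are extended reals: the infimum of the empty set is [+oo],
   whereas the real-valued [inf] would return the junk value 0. *)
Definition log_hausdorff_dist K L : \bar R :=
  ereal_inf [set l%:E | l in [set l : R | 1 <= l /\
    exists x, [/\ (K `&` L)° x, homothety x l^-1 K `<=` L
                & L `<=` homothety x l K]]].

Definition banach_mazur_dist K L : \bar R :=
  ereal_inf [set l%:E | l in [set l : R | 1 <= l /\
    exists x, exists T, [/\ affine_transformation T, K `<=` T @` L
                          & T @` L `<=` homothety x l K]]].

End floating_body.

(* Main.v *)
(* Put s = delta^(1/d) and let l > 1 + 8s. By Fubini, the average over x in K of
   vol (K `&` (2x - K)) is vol K / 2^d, so some x in K has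
   vol (K `&` (2x - K)) > c vol K / 2^d, where c < 1 is as close to 1 as needed.
   This intersection is symmetric about x, so every half-space whose boundary
   passes through x cuts from K a piece of volume > c vol K / 2^(d+1).
   Contracting slightly towards an interior point makes x interior to K. If a
   point l^-1 (z - x) + x with z in K lay outside a half-space H containing a
   fraction 1 - delta of K, then the homothety of center z and ratio 1 - l^-1
   would map the piece lying beyond x into K minus H; since 1 - l^-1 > 4s, the
   image has volume > (4s)^d vol K / 2^(d+1) >= delta vol K, a contradiction.
   Hence l^-1 (K - x) + x is contained in K_delta, which is contained in K by
   separation; the two distances follow, the second one with 8 in place of
   24. *)
Require Import Defs.
From mathcomp Require Import all_boot all_order all_algebra.
From mathcomp Require Import all_classical all_reals all_analysis.
From mathcomp Require Import measurable_realfun ring lra.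
Import Order.TTheory GRing.Theory Num.Theory.
Import numFieldNormedType.Exports.
Local Open Scope classical_set_scope.
Local Open Scope ring_scope.

Set Implicit Arguments.
Unset Strict Implicit.
Unset Printing Implicit Defensive.

(** * Lebesgue measure under homotheties and translations *)

Lemma scaled_image_measure d1 d2 (T1 : measurableType d1)
    (T2 : measurableType d2) (R : realType)
    (m : {measure set T1 -> \bar R}) (f : T1 -> T2) (r : R) :
  0 <= r -> measurable_fun setT f ->
  exists m' : {measure set T2 -> \bar R},
    forall A, m' A = (r%:E * m (f @^-1` A))%E.
Proof.
move=> r0 mf; unshelve eexists.
  apply: (mscale (NngNum r0) (pushforward m f) : {measure set _ -> \bar _}).
  exact: mf.
by [].
Qed.

Lemma measurable_affine1 {R : realType} (a b : R) :
  measurable_fun setT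
    (fun x : measurableTypeR R => a * x + b : measurableTypeR R).
Proof. exact: (@measurable_funD _ _ R setT ( *%R a) (cst b)). Qed.

(** By uniqueness of Lebesgue measure it suffices to compare both sides, each a measure in [A], on
    half-open intervals. *)
Lemma lebesgue_measure_affine {R : realType} (a b : R) (A : set R) :
  a != 0 -> measurable A ->
  (`|a|%:E * lebesgue_measure (fun x : R => A (a * x + b)%R)
    = lebesgue_measure A)%E.
Proof.
move=> a0 mA.
pose f : R -> measurableTypeR R := fun x => a * x + b.
have mf : measurable_fun setT f := measurable_affine1 a b.
have [m' m'E] := scaled_image_measure (@lebesgue_measure R) (normr_ge0 a) mf.
rewrite -[LHS]m'E; apply/esym/lebesgue_measure_unique => //= _ [[p q]] _ <-.
rewrite m'E.
have [a_gt0|] := ltP 0 a.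
  rewrite (_ : _ @^-1` _ = `](p - b) / a, (q - b) / a]%classic); last first.
    apply/seteqP; split => x; rewrite /f /= !in_itv/=
      ltr_pdivrMr// ler_pdivlMr// ltrBlDr lerBrDr (mulrC x) => //.
  rewrite [X in (_ * X)%E]lebesgue_measure_itv lebesgue_measure_itv/= !lte_fin.
  rewrite ltr_pM2r ?invr_gt0// ltrD2r.
  case: ifPn => _; last by rewrite mule0.
  rewrite -!EFinB -EFinM gtr0_norm//; congr EFin; field => //.
rewrite le_eqVlt (negbTE a0)/= => a_lt0.
(* A negative slope reverses the interval, so its closed end is now on the left. *)
rewrite (_ : _ @^-1` _ = `[(q - b) / a, (p - b) / a[%classic); last first.
  apply/seteqP; split => x; rewrite /f /= !in_itv/=
    ltr_ndivlMr// ler_ndivrMr// ltrBlDr lerBrDr (mulrC x) andbC => //.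
rewrite [X in (_ * X)%E]lebesgue_measure_itv lebesgue_measure_itv/= !lte_fin.
rewrite ltr_nM2r ?invr_lt0// ltrD2r.
case: ifPn => _; last by rewrite mule0.
rewrite -!EFinB -EFinM ltr0_norm//; congr EFin; field => //.
Qed.

Section lebesgue_tuple_affine.
Context {R : realType}.
Notation mR := (measurableTypeR R).

Definition affine_tuple n (a : R) (b : 'I_n -> R) (u : n.-tuple mR) :
  n.-tuple mR := [tuple a * tnth u i + b i | i < n].

Lemma measurable_affine_tuple n (a : R) (b : 'I_n -> R) :
  measurable_fun setT (affine_tuple a b).
Proof.
apply/measurable_fun_tnthP => i.
rewrite (_ : _ \o _ = (fun x : mR => a * x + b i : mR) \o (@tnth n mR ^~ i)).
  by apply: measurableT_comp; [exact: measurable_affine1|exact: measurable_tnth].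
by apply/funext => u /=; rewrite tnth_mktuple.
Qed.

Lemma affine_tcons n (a : R) (b : 'I_n.+1 -> R) (p : mR * n.-tuple mR) :
  affine_tuple a b (tcons p) =
  tcons (a * p.1 + b ord0 : mR, affine_tuple a (b \o lift ord0) p.2).
Proof.
apply: eq_from_tnth => i; rewrite tnth_mktuple.
by have [j ->|->] := unliftP ord0 i; rewrite ?tnthS ?tnth0 ?tnth_mktuple.
Qed.

(** Induction on [n] through uniqueness of product measures: on a rectangle, the line contributes a
    factor |a| and the remaining coordinates |a|^n. *)
Lemma lebesgue_tuple_affine n (a : R) (b : 'I_n -> R) (A : set (n.-tuple mR)) :
  a != 0 -> measurable A ->
  ((`|a| ^+ n)%:E * lebesgue_tuple n (affine_tuple a b @^-1` A)
    = lebesgue_tuple n A)%E.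
Proof.
move=> a0; elim: n b A => [|n IH] b A mA.
  rewrite expr0 mul1e; congr (lebesgue_tuple 0 _).
  by apply/seteqP; split => u;
    rewrite /preimage/= [affine_tuple _ _ _]tuple0 [u]tuple0.
pose g (p : mR * n.-tuple mR) : mR * n.-tuple mR :=
  (a * p.1 + b ord0 : mR, affine_tuple a (b \o lift ord0) p.2).
have mg : measurable_fun setT g.
  apply: measurable_fun_pair.
    by apply: (measurableT_comp (measurable_affine1 a (b ord0))).
  by apply: (measurableT_comp (measurable_affine_tuple a (b \o lift ord0))).
have an_ge0 : 0 <= `|a| ^+ n.+1 by rewrite exprn_ge0.
have mtcA : measurable (@tcons R n @^-1` A).
  by rewrite -[X in measurable X]setTI; exact: measurable_tcons.
have [m' m'E] := scaled_image_measure
  (@lebesgue_measure R \x lebesgue_tuple n)%E an_ge0 mg.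
rewrite /= /lebesgue_tcons /pushforward.
rewrite [RHS](@product_measure_unique _ _ _ _ _ _ _ m' _ _ mtcA); last first.
  move=> B C mB mC; rewrite m'E.
  rewrite (_ : g @^-1` _ = (fun x : mR => a * x + b ord0) @^-1` B `*`
     (affine_tuple a (b \o lift ord0) @^-1` C)) //=.
  rewrite product_measure1E; last 2 first.
  - by rewrite -[X in measurable X]setTI; apply: measurable_affine1.
  - by rewrite -[X in measurable X]setTI; apply: measurable_affine_tuple.
  rewrite -(lebesgue_measure_affine (b ord0) a0 mB).
  rewrite -[in RHS](IH (b \o lift ord0) C mC).
  by rewrite exprS EFinM muleACA.
rewrite m'E; congr (_ * _)%E; congr product_measure1.
by apply/funext => p; rewrite /preimage /= affine_tcons.
Qed.

End lebesgue_tuple_affine.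

(** * Volume on row vectors: balls, measurability, scaling *)

Section volume.
Context {R : realType}.
Notation mR := (measurableTypeR R).

Lemma measurable_tuple_box n (I : 'I_n -> set mR) :
  (forall i, measurable (I i)) ->
  measurable [set u : n.-tuple mR | forall i, I i (tnth u i)].
Proof.
move=> mI.
rewrite (_ : [set u | _] = \bigcap_(i in [set: 'I_n]) (@tnth n mR ^~ i @^-1` I i)).
  apply: fin_bigcap_measurable => // i _.
  by rewrite -[X in measurable X]setTI; apply: measurable_tnth.
by apply/seteqP; split => [u uI i _|u uI i]; [exact: uI|exact: uI].
Qed.

Lemma lebesgue_tuple_box n (I : 'I_n -> set mR) (r : R) :
  (forall i, measurable (I i)) -> (forall i, lebesgue_measure (I i) = r%:E) ->
  lebesgue_tuple n [set u | forall i, I i (tnth u i)] = (r ^+ n)%:E.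
Proof.
elim: n I => [|n IH] I mI Ir.
  by rewrite /= diracE mem_set// => -[].
rewrite /= /lebesgue_tcons /pushforward.
rewrite (_ : _ @^-1` _ =
    I ord0 `*` [set u | forall i, I (lift ord0 i) (tnth u i)]).
  rewrite product_measure1E//; last first.
    by apply: (measurable_tuple_box (I := fun i => I (lift ord0 i))).
  rewrite [X in (X * _)%E](Ir ord0) (IH (fun i => I (lift ord0 i)))//.
  by rewrite exprS EFinM.
apply/seteqP; split => -[x u]/=.
  move=> h; split; first by have := h ord0; rewrite tnth0.
  by move=> i; have := h (lift ord0 i); rewrite tnthS.
move=> [Ix Iu] i; have [j ->|->] := unliftP ord0 i; first by rewrite tnthS.
by rewrite tnth0.
Qed.

Context {d : nat}.
Implicit Types (A B : set 'rV[R]_d).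

Definition row_of_tuple (u : d.-tuple mR) : 'rV[R]_d := \row_i tnth u i.

(* [vol A] is a measure of [A] only when [A] is measurable as a set of tuples. *)
Definition vol_measurable A := measurable (row_of_tuple @^-1` A).

Lemma row_ballP (x y : 'rV[R]_d) e : 0 < e ->
  ball x e y <-> forall i, ball (x 0 i) e (y 0 i).
Proof.
by move=> e0; split => [[_ h] i|h]; [exact: h|split => // i j; rewrite !ord1].
Qed.

Lemma row_of_tuple_ball c e : 0 < e ->
  row_of_tuple @^-1` ball c e =
  [set u | forall i, `]c 0 i - e, c 0 i + e[%classic (tnth u i)].
Proof.
move=> e0; apply/seteqP; split => u /=; rewrite row_ballP// => h i;
  by have := h i; rewrite ball_itv /= !mxE.
Qed.

Lemma vol_measurable_ball c e : 0 < e -> vol_measurable (ball c e).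
Proof.
move=> e0; rewrite /vol_measurable row_of_tuple_ball//.
apply: (measurable_tuple_box (I := fun i => `]c 0 i - e, c 0 i + e[%classic)).
by move=> i; exact: measurable_itv.
Qed.

Lemma vol_ball (c : 'rV[R]_d) e : 0 < e -> vol (ball c e) = ((2 * e) ^+ d)%:E.
Proof.
move=> e0; rewrite /vol -/(row_of_tuple @^-1` _) row_of_tuple_ball//.
apply: (lebesgue_tuple_box (I := fun i => `]c 0 i - e, c 0 i + e[%classic)) => i.
  exact: measurable_itv.
rewrite lebesgue_measure_itv/= lte_fin ifT; last lra.
by rewrite -EFinB; congr EFin; ring.
Qed.

(** An open set is the union of the balls of rational centre and radius 1/(k+1) that it contains,
    and these are countably many. *)
Lemma open_vol_measurable A : open A -> vol_measurable A.
Proof.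
move=> oA.
pose B (p : 'rV[rat]_d * nat) : set 'rV[R]_d :=
  ball (map_mx ratr p.1 : 'rV[R]_d) p.2.+1%:R^-1.
rewrite /vol_measurable (_ : row_of_tuple @^-1` A =
   \bigcup_p [set u | B p `<=` A /\ B p (row_of_tuple u)]).
  apply: countable_bigcupT_measurable; first exact: countableP.
  move=> p; have [pA|npA] := pselect (B p `<=` A).
    rewrite (_ : [set _ | _] = row_of_tuple @^-1` B p).
      by apply: vol_measurable_ball; rewrite invr_gt0.
    by apply/seteqP; split => [u []|].
  rewrite (_ : [set _ | _] = set0); first exact: measurable0.
  by apply/seteqP; split => // u [].
apply/seteqP; split => u /=; last by move=> [p _ [pA]]; exact: pA.
move=> Au.
have /nbhs_ballP[e /= e0 eA] : nbhs (row_of_tuple u) A by exact: open_nbhs_nbhs.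
(* One radius covers the distance from the given point to a rational centre, a second one the
   distance from that centre to any point of its ball; together they stay below [e]. *)
have [k ke] : exists k : nat, k.+1%:R^-1 < e / 2.
  have := near_infty_natSinv_lt (PosNum (divr_gt0 e0 (ltr0n R 2))).
  by case=> k _ /(_ k (leqnn k)) /=; exists k.
have k0 : 0 < k.+1%:R^-1 :> R by rewrite invr_gt0.
have rat_near (y h : R) : 0 < h -> exists q : rat, ball (ratr q : R) h y.
  move=> h0; have [|q] := @rat_in_itvoo R (y - h) (y + h); first lra.
  by rewrite in_itv/= => qy; exists q; rewrite /ball/= ltr_distl.
have /choice[q qP] (i : 'I_d) := rat_near (tnth u i) _ k0.
have pA : ball (map_mx ratr (\row_i q i) : 'rV[R]_d) k.+1%:R^-1 `<=` A.
  move=> y; rewrite row_ballP// => qy; apply: eA.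
  rewrite row_ballP// => i; rewrite mxE.
  apply: (@le_ball _ _ _ (k.+1%:R^-1 + k.+1%:R^-1)).
    by rewrite [e]splitr ltW ?ltrD.
  apply: ball_triangle (qy i); rewrite !mxE; exact/ball_sym/qP.
exists (\row_i q i, k) => //; split => //.
by rewrite /B row_ballP// => i; rewrite !mxE.
Qed.

Lemma vol_measurableC A : vol_measurable A -> vol_measurable (~` A).
Proof. by move=> mA; apply: measurableC. Qed.

Lemma vol_measurableI A B :
  vol_measurable A -> vol_measurable B -> vol_measurable (A `&` B).
Proof. by move=> mA mB; apply: measurableI. Qed.

Lemma closed_vol_measurable A : closed A -> vol_measurable A.
Proof.
move=> /closed_openC/open_vol_measurable/vol_measurableC.
by rewrite setCK.
Qed.

Lemma le_vol A B :
  vol_measurable A -> vol_measurable B -> A `<=` B -> (vol A <= vol B)%E.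
Proof.
by move=> mA mB AB; apply: le_measure; rewrite ?inE//; exact: preimage_subset.
Qed.

Lemma volU A B : vol_measurable A -> vol_measurable B ->
  A `&` B = set0 -> vol (A `|` B) = (vol A + vol B)%E.
Proof.
move=> mA mB AB0; apply: (measureU (lebesgue_tuple d) mA mB).
by rewrite -preimage_setI AB0 preimage_set0.
Qed.

Lemma le_volU A B : vol_measurable A -> vol_measurable B ->
  (vol (A `|` B) <= vol A + vol B)%E.
Proof. by move=> mA mB; apply: (measureU2 (lebesgue_tuple d)). Qed.

Lemma row_of_tuple_affine (a : R) (b : 'rV[R]_d) u :
  row_of_tuple (affine_tuple a (b 0) u) = a *: row_of_tuple u + b.
Proof. by apply/rowP => i; rewrite !mxE tnth_mktuple. Qed.

Lemma vol_measurable_affine (a : R) (b : 'rV[R]_d) A : vol_measurable A ->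
  vol_measurable [set x | A (a *: x + b)].
Proof.
move=> mA; rewrite /vol_measurable (_ : _ @^-1` _ =
    affine_tuple a (b 0) @^-1` (row_of_tuple @^-1` A)).
  by rewrite -[X in measurable X]setTI; apply: measurable_affine_tuple.
by apply/funext => u; rewrite /preimage/= row_of_tuple_affine.
Qed.

(** Negative ratios are included: [a = -1] gives the invariance of volume under point
    reflections. *)
Lemma vol_affine (a : R) (b : 'rV[R]_d) A : a != 0 -> vol_measurable A ->
  ((`|a| ^+ d)%:E * vol [set x | A (a *: x + b)%R] = vol A)%E.
Proof.
move=> a0 mA; rewrite -[RHS](lebesgue_tuple_affine (b 0) a0 mA).
congr (_ * lebesgue_tuple d _)%E.
by apply/funext => u; rewrite /preimage/= row_of_tuple_affine.
Qed.

End volume.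

(** * Intersections of a set with its point reflections *)

Section reflection.
Context {R : realType} {d : nat}.
Notation mR := (measurableTypeR R).
Implicit Types (K : set 'rV[R]_d).

(** The part of convexity that the Fubini argument uses: a set is disjoint from its reflection
    through a point outside it. *)
Definition midpoint_convex K := forall x y, K y -> K (2 *: x - y) -> K x.

(** The section over a first component x is K [&] (2x - K); the one over a second component y in K
    is (K + y) / 2, whose volume does not depend on y. *)
Let refl_pairs K : set (d.-tuple mR * d.-tuple mR) :=
  [set p | K (row_of_tuple p.2) /\
           K (2 *: row_of_tuple p.1 - row_of_tuple p.2)].

Let measurable_refl_pairs K : vol_measurable K -> measurable (refl_pairs K).
Proof.
move=> mK.
pose h (p : d.-tuple mR * d.-tuple mR) : d.-tuple mR :=
  [tuple (2 * tnth p.1 i - tnth p.2 i : mR) | i < d].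
have mh : measurable_fun setT h.
  apply/measurable_fun_tnthP => i.
  rewrite (_ : _ \o _ = fun p => (2 * tnth p.1 i - tnth p.2 i : R)).
    apply: (@measurable_funB _ _ R setT
      ( *%R (2 : R) \o (fun p => tnth p.1 i)) (fun p => tnth p.2 i)).
      apply: measurableT_comp; first exact: mulrl_measurable.
      exact: (measurableT_comp (measurable_tnth i) measurable_fst).
    exact: (measurableT_comp (measurable_tnth i) measurable_snd).
  by apply/funext => p /=; rewrite tnth_mktuple.
rewrite (_ : refl_pairs K =
    snd @^-1` (row_of_tuple @^-1` K) `&` h @^-1` (row_of_tuple @^-1` K)).
  apply: measurableI.
    by rewrite -[X in measurable X]setTI; apply: measurable_snd.
  by rewrite -[X in measurable X]setTI; apply: mh.
rewrite /refl_pairs /preimage/=; apply/funext => p /=; congr (_ /\ K _).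
by apply/rowP => i; rewrite !mxE tnth_mktuple.
Qed.

(* By Fubini, [vol (K `&` (2x - K))] integrates over [x] to [v ^+ 2 / 2 ^+ d],
   and it vanishes for [x] outside [K]. *)
Lemma exists_big_reflection K (v k : R) :
  vol_measurable K -> midpoint_convex K -> vol K = v%:E -> 0 < v ->
  k < v / 2 ^+ d ->
  exists2 x, K x & (k%:E < vol (K `&` [set y | K (2 *: x - y)%R]))%E.
Proof.
move=> mK cK Kv v0 kv; apply: contrapT => /forall2NP h.
pose mu := @lebesgue_tuple R d.
pose tK := row_of_tuple @^-1` K : set (d.-tuple mR).
have muE x : mu (xsection (refl_pairs K) x) =
    vol (K `&` [set y | K (2 *: row_of_tuple x - y)]).
  by congr (mu _); apply/seteqP; split => y; rewrite /xsection/= inE.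
have Fub : (\int[mu]_x mu (xsection (refl_pairs K) x)
    = \int[mu]_y mu (ysection (refl_pairs K) y))%E.
  have := indic_fubini_tonelli mu mu (measurable_refl_pairs mK).
  by rewrite indic_fubini_tonelli_FE ?indic_fubini_tonelli_GE //;
    exact: measurable_refl_pairs.
have le1 : (\int[mu]_x mu (xsection (refl_pairs K) x) <= k%:E * v%:E)%E.
  rewrite -Kv -[vol K]/(mu tK) -integral_cst //.
  rewrite [leRHS]integral_mkcond; apply: ge0_le_integral => //.
  - exact: measurable_fun_xsection (measurable_refl_pairs mK).
  - by apply/(measurable_restrictT _ _).1 => //; exact: measurable_cst.
  move=> x _; rewrite patchE; case: ifPn => [|].
    rewrite inE /tK/= => Kx; rewrite muE leNgt; apply/negP.
    by have [/(_ Kx)|] := h (row_of_tuple x).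
  rewrite notin_setE /tK/= => nKx; rewrite muE (_ : _ `&` _ = set0).
    by rewrite [vol _]measure0.
  by apply/seteqP; split => // y [Ky] /(cK _ _ Ky) /nKx.
have eq2 : (\int[mu]_y mu (ysection (refl_pairs K) y)
    = (v / 2 ^+ d)%:E * v%:E)%E.
  rewrite -Kv -[vol K]/(mu tK) -integral_cst // [RHS]integral_mkcond.
  apply: eq_integral => y _; rewrite patchE; case: ifPn.
    rewrite inE /tK/= => Ky.
    have -> : mu (ysection (refl_pairs K) y) =
        vol [set x | K (2 *: x + - row_of_tuple y)].
      congr (mu _); apply/seteqP; split => x; rewrite /ysection/= inE//=.
      by move=> [].
    have n2 : 2 != 0 :> R by [].
    have := vol_affine (- row_of_tuple y) n2 mK.
    rewrite Kv ger0_norm// => /(congr1 (fun z => ((2 ^+ d)^-1)%:E * z)%E).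
    rewrite muleA -!EFinM mulVf ?expf_neq0// mul1e => ->.
    by rewrite mulrC.
  rewrite notin_setE /tK/= => nKy.
  rewrite (_ : ysection _ _ = set0) ?measure0//.
  by apply/seteqP; split => // x; rewrite /ysection/= inE => -[].
have := le1; rewrite Fub eq2 -!EFinM lee_fin ler_pM2r// leNgt kv//.
Qed.

End reflection.

(** * Inner product, convex bodies and half-spaces *)

Section convex_geometry.
Context {R : realType} {d : nat}.
Implicit Types (K : set 'rV[R]_d) (x y z theta : 'rV[R]_d).

Lemma dotpDl x y z : dotp (x + y) z = dotp x z + dotp y z.
Proof.
by rewrite /dotp -big_split; apply: eq_bigr => i _; rewrite mxE mulrDl.
Qed.

Lemma dotpZl (a : R) x y : dotp (a *: x) y = a * dotp x y.
Proof. by rewrite /dotp big_distrr; apply: eq_bigr => i _; rewrite mxE -mulrA. Qed.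

Lemma dotpC x y : dotp x y = dotp y x.
Proof. by apply: eq_bigr => i _; rewrite mulrC. Qed.

Lemma dotpNl x y : dotp (- x) y = - dotp x y.
Proof. by rewrite -scaleN1r dotpZl mulN1r. Qed.

Lemma dotpBl x y z : dotp (x - y) z = dotp x z - dotp y z.
Proof. by rewrite dotpDl dotpNl. Qed.

Lemma dotpZr (a : R) x y : dotp x (a *: y) = a * dotp x y.
Proof. by rewrite dotpC dotpZl dotpC. Qed.

Lemma dotp_ge0 x : 0 <= dotp x x.
Proof. by apply: sumr_ge0 => i _; rewrite -expr2 sqr_ge0. Qed.

Lemma dotp_eq0 x : dotp x x = 0 -> x = 0.
Proof.
move=> /psumr_eq0P h; apply/rowP => i; rewrite mxE.
have /eqP := h (fun i _ => (sqr_ge0 (x 0 i))) i isT.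
by rewrite mulf_eq0 orbb => /eqP.
Qed.

(** The factor [t] is pulled out so that a minimality condition at [t = 0] can be divided by
    [t > 0]. *)
Lemma dotpZD_sqr (t : R) x y : dotp (t *: x + y) (t *: x + y) =
  t * (2 * dotp x y + t * dotp x x) + dotp y y.
Proof.
rewrite dotpDl dotpZl ![dotp _ (_ + _)]dotpC !dotpDl !dotpZl (dotpC y x).
by ring.
Qed.

Lemma continuous_dotp_sub y : continuous (fun x => dotp (x - y) (x - y)).
Proof.
apply: continuous_big => [|i _ x]; first exact: add_continuous.
have c : {for x, continuous (fun x => (x - y) 0 i)}.
  rewrite (_ : (fun x => _) = (fun x : 'rV[R]_d => x 0 i - y 0 i)).
    by apply: continuousB; [exact: coord_continuous|exact: cst_continuous].
  by apply/funext => z; rewrite !mxE.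
exact: (cvgM c c).
Qed.

Lemma continuous_dotp theta : continuous (fun x => dotp x theta).
Proof.
apply: continuous_big => [|i _ x]; first exact: add_continuous.
by apply: continuousM; [exact: coord_continuous|exact: cst_continuous].
Qed.

Lemma convex_comb K (t : R) x y : convex_set (K : set (convex_lmodType 'rV[R]_d)) ->
  0 <= t -> t <= 1 -> K x -> K y -> K (t *: x + (1 - t) *: y).
Proof.
move=> cK t0 t1 Kx Ky.
by have := cK x y (Itv01 t0 t1); rewrite !inE; apply.
Qed.

Lemma closed_halfspace theta t : closed (halfspace theta t).
Proof.
by apply: (closed_comp _ (@closed_ge R t)) => x _; exact: continuous_dotp.
Qed.

Lemma closed_halfspace_le theta t : closed [set x | dotp x theta <= t].
Proof.
by apply: (closed_comp _ (@closed_le R t)) => x _; exact: continuous_dotp.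
Qed.

Lemma compact_vol_measurable K : compact K -> vol_measurable K.
Proof.
move=> cK; apply: closed_vol_measurable.
by apply: compact_closed => //; exact: norm_hausdorff.
Qed.

(** A ball inside [K] gives positivity, a ball around [K] finiteness. *)
Lemma convex_body_vol K : convex_body K -> exists2 v : R, 0 < v & vol K = v%:E.
Proof.
move=> [cK _ [z /= /nbhs_ballP[e /= e0 eK]]].
have mK := compact_vol_measurable cK.
have lo : (((2 * e) ^+ d)%:E <= vol K)%E.
  by rewrite -(vol_ball z e0); apply: le_vol => //; exact: vol_measurable_ball.
have /ex_strict_bound_gt0[M M0 /= KM] := compact_bounded cK.
have hi : (vol K <= ((2 * M) ^+ d)%:E)%E.
  rewrite -(vol_ball 0 M0); apply: le_vol => //; first exact: vol_measurable_ball.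
  by move=> x /KM; rewrite mx_norm_ball /ball_ /= sub0r normrN.
have fK : vol K \is a fin_num.
  have K0 : (0 <= vol K)%E by exact: measure_ge0.
  by rewrite ge0_fin_numE//; apply: le_lt_trans hi _; exact: ltry.
exists (fine (vol K)); last by rewrite fineK.
rewrite -lte_fin fineK//; apply: lt_le_trans lo.
by rewrite lte_fin exprn_gt0// mulr_gt0.
Qed.

Lemma homothety_interior K x z (r : R) :
  convex_set (K : set (convex_lmodType 'rV[R]_d)) ->
  0 <= r -> r < 1 -> K x -> K° z -> K° (z + r *: (x - z)).
Proof.
move=> cK r0 r1 Kx /nbhs_ballP[e /= e0 eK].
have r'0 : 0 < 1 - r by rewrite subr_gt0.
apply/nbhs_ballP; exists ((1 - r) * e) => /=; first exact: mulr_gt0.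
move=> y; rewrite mx_norm_ball /ball_ /= => xy.
(* [w] is the preimage of [y] under the homothety of centre [x] and ratio [1 - r], which maps [z] to
   the new point; hence [w] is within [e] of [z]. *)
pose w := z + (1 - r)^-1 *: (y - (z + r *: (x - z))).
have Kw : K w.
  apply: eK; rewrite mx_norm_ball /ball_ /= /w opprD addrA subrr add0r normrN.
  by rewrite mx_normZ gtr0_norm ?invr_gt0// mulrC ltr_pdivrMr// distrC mulrC.
have -> : y = r *: x + (1 - r) *: w.
  rewrite /w scalerDr scalerA divff ?gt_eqF// scale1r.
  by apply/rowP => i; rewrite !mxE; ring.
by apply: convex_comb => //; exact: ltW.
Qed.

(** Let [k] be the point of [K] nearest to [y]. If [k] differs from [y], the half-space through [k]
    with inner normal [k - y] contains [K] but not [y], and it takes part in the intersection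
    because it cuts off nothing. *)
Lemma floating_body_sub K delta : convex_body K -> 0 <= delta ->
  floating_body K delta `<=` K.
Proof.
move=> bK delta0 y yK.
have [cK convK [x0 /interior_subset Kx0]] := bK.
have mK := compact_vol_measurable cK.
have [v v0 Kv] := convex_body_vol bK.
have [k kK kmin] : exists2 k, K k &
    forall x, K x -> dotp (k - y) (k - y) <= dotp (x - y) (x - y).
  have [|k kK kmin] := @EVT_min_rV R d (fun x => dotp (x - y) (x - y)) K
    (ex_intro _ x0 Kx0) cK.
  - by apply: continuous_subspaceT; exact: continuous_dotp_sub.
  - by exists k; [exact: set_mem|move=> x Kx; apply: kmin; exact: mem_set].
set g := k - y in kmin *.
have [/dotp_eq0 g0|g_neq0] := eqVneq (dotp g g) 0.
  by rewrite (_ : y = k) //; apply/esym/eqP; rewrite -subr_eq0 -/g g0.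
have g_gt0 : 0 < dotp g g by rewrite lt_def g_neq0 dotp_ge0.
(* Otherwise moving from [k] slightly towards [x] would come closer to [y]. *)
have ksupp x : K x -> 0 <= dotp (x - k) g.
  move=> Kx; rewrite leNgt; apply/negP => xk0.
  set p := dotp (x - k) g in xk0.
  set q := dotp (x - k) (x - k).
  have q0 : 0 <= q by exact: dotp_ge0.
  have step t : 0 <= t -> t <= 1 -> 0 <= t * (2 * p + t * q).
    move=> t0 t1; have := kmin _ (convex_comb convK t0 t1 Kx kK).
    rewrite (_ : _ - y = t *: (x - k) + g); last first.
      by apply/rowP => i; rewrite /g !mxE; ring.
    rewrite dotpZD_sqr -/p -/q => h; lra.
  (* [t = - p / (q - p)] makes [2 * p + t * q] negative; unlike the minimizer
     [- p / q] it is at most 1. *)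
  have t0 : 0 < - p / (q - p) by rewrite divr_gt0//; lra.
  have qp : 0 < q - p by lra.
  have t1 : - p / (q - p) <= 1 by rewrite ler_pdivrMr//; lra.
  have := step _ (ltW t0) t1; rewrite pmulr_rge0//.
  rewrite leNgt => /negP; apply.
  have -> : 2 * p + - p / (q - p) * q = p + (- p^+2) / (q - p).
    by field; rewrite gt_eqF.
  have : 0 <= p ^+ 2 / (q - p) by rewrite divr_ge0// ?sqr_ge0// ltW.
  by rewrite mulNr; lra.
pose N := Num.sqrt (dotp g g).
have N0 : 0 < N by rewrite sqrtr_gt0.
pose theta := N^-1 *: g.
have thetaS : unit_sphere theta.
  rewrite /unit_sphere/= /theta dotpZl dotpZr -(sqr_sqrtr (ltW g_gt0)) -/N.
  rewrite (_ : _ * _ = 1) ?sqrtr1//; field; exact: lt0r_neq0.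
have KH : halfspace theta (dotp k theta) `&` K = K.
  apply/setIidPr => x Kx; rewrite /halfspace/= /theta !dotpZr.
  rewrite ler_pM2l ?invr_gt0// -subr_ge0 -dotpBl; exact: ksupp.
have /= := yK (theta, dotp k theta); rewrite KH Kv -EFinM lee_fin.
rewrite /halfspace/= /theta !dotpZr ler_pM2l ?invr_gt0// => yk.
have := yk (conj thetaS _); rewrite ler_piMl ?(ltW v0)//; last lra.
move=> /(_ isT).
by rewrite -subr_le0 -dotpBl -/g leNgt g_gt0.
Qed.

(** Reflection through [x] exchanges the two sides of the hyperplane through [x], so the symmetric
    intersection is covered by [D] and its mirror image, which have equal volume. *)
Lemma vol_reflection_le K x theta : vol_measurable K ->
  (vol (K `&` [set y | K (2 *: x - y)%R])
    <= 2%:E * vol (K `&` [set y | dotp y theta <= dotp x theta]%R))%E.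
Proof.
move=> mK; set D := _ `&` [set y | _ <= _].
have mD : vol_measurable D.
  by apply: vol_measurableI => //; apply: closed_vol_measurable;
    exact: closed_halfspace_le.
have N1 : -1 != 0 :> R by rewrite oppr_eq0 oner_eq0.
have mD' := vol_measurable_affine (-1) (2 *: x) mD.
have := vol_affine (2 *: x) N1 mD; rewrite normrN1 expr1n mul1e => D'D.
apply: (@le_trans _ _ (vol (D `|` [set y | D (-1 *: y + 2 *: x)]))).
  apply: le_vol.
  - apply: vol_measurableI => //.
    rewrite (_ : [set y | _] = [set y | K (-1 *: y + 2 *: x)]).
      exact: vol_measurable_affine.
    by apply/funext => y; rewrite /= scaleN1r addrC.
  - exact: measurableU mD mD'.
  move=> y [Ky K2xy] /=.
  have [yx|xy] := leP (dotp y theta) (dotp x theta); first by left; split.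
  right; rewrite /D/= scaleN1r addrC; split => //.
  rewrite dotpBl dotpZl; lra.
apply: le_trans (le_volU mD mD') _.
have -> : (2%:E = 1 + 1 :> \bar R)%E by rewrite -EFinD.
by rewrite D'D ge0_muleDl// !mul1e.
Qed.

End convex_geometry.

(** * A homothetic copy of the body inside its floating body *)

Section floating.
Context {R : realType} {d : nat}.
Implicit Types (K : set 'rV[R]_d) (x y z theta : 'rV[R]_d).

Lemma convex_midpoint K : convex_set (K : set (convex_lmodType 'rV[R]_d)) ->
  midpoint_convex K.
Proof.
move=> cK x y Ky K2; rewrite (_ : x = 2^-1 *: y + (1 - 2^-1) *: (2 *: x - y)).
  by apply: convex_comb => //; lra.
by apply/rowP => i; rewrite !mxE; field.
Qed.

Lemma exists_deep_point K (v c : R) :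
  convex_body K -> vol K = v%:E -> 0 < v -> c < 1 ->
  exists2 x, K x & forall theta,
    ((c * v / 2 ^+ d.+1)%:E
      < vol (K `&` [set y | dotp y theta <= dotp x theta]%R))%E.
Proof.
move=> [cK convK _] Kv v0 c1.
have mK := compact_vol_measurable cK.
have d2 : 0 < 2 ^+ d :> R by rewrite exprn_gt0.
have [|x Kx hx] := @exists_big_reflection R d K v (c * v / 2 ^+ d) mK
  (convex_midpoint convK) Kv v0.
  by rewrite ltr_pM2r ?invr_gt0// gtr_pMl.
exists x => // theta; have := lt_le_trans hx (vol_reflection_le x theta mK).
rewrite (_ : c * v / 2 ^+ d = 2 * (c * v / 2 ^+ d.+1)).
  by rewrite EFinM lte_pmul2l.
by rewrite exprS; field; rewrite lt0r_neq0.
Qed.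

(** In [floating_body_homothety] one factor [r] pays for moving the deep point into the interior,
    the other for the constant [c = r ^+ d] of [exists_deep_point]. *)
Lemma exists_shrink_ratio (a b : R) : 0 < a -> a < b ->
  exists r, [/\ 0 < r, r < 1 & a <= r ^+ 2 * b].
Proof.
move=> a0 ab; have b0 : 0 < b by exact: lt_trans ab.
(* The arithmetic mean of 1 and a/b dominates their geometric mean, so its square is at least
   a/b. *)
exists ((1 + a / b) / 2).
have q0 : 0 < a / b by rewrite divr_gt0.
have q1 : a / b < 1 by rewrite ltr_pdivrMr ?mul1r.
split; [lra|lra|].
rewrite -ler_pdivrMr//; set q := a / b.
rewrite -subr_ge0 (_ : _ - _ = ((1 - q) / 2) ^+ 2) ?sqr_ge0//.
by field.
Qed.

Lemma floating_body_homothety K (s l : R) : (0 < d)%N ->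
  convex_body K -> 0 < s -> s <= 8^-1 -> 1 + 8 * s < l ->
  exists2 x, K° x & homothety x l^-1 K `<=` floating_body K (s ^+ d).
Proof.
move=> d0 bK s0 s8 sl.
have [cK convK [z0 z0K]] := bK.
have mK := compact_vol_measurable cK.
have [v v0 Kv] := convex_body_vol bK.
have l0 : 0 < l by lra.
pose rho := 1 - l^-1.
(* The claim is (1 - 4s) l > 1. It follows from l > 1 + 8s, since (1 - 4s)(1 + 8s) = 1 + 4s(1 - 8s)
   >= 1 for s <= 1/8. *)
have rho_lb : 4 * s < rho.
  rewrite /rho ltrBrDl -ltrBrDr -[ltLHS]mul1r ltr_pdivrMr//.
  have : 0 < (1 - 4 * s) * (l - (1 + 8 * s)) by apply: mulr_gt0; lra.
  have : 0 <= s * (1 - 8 * s) by apply: mulr_ge0; lra.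
  by lra.
have rho0 : 0 < rho by lra.
have s40 : 0 < 4 * s by lra.
have [r [r0 r1 r_lb]] := exists_shrink_ratio s40 rho_lb.
have rd1 : r ^+ d < 1 by rewrite exprn_ilt1 ?ltW// -lt0n.
have [x Kx deepx] := exists_deep_point bK Kv v0 rd1.
exists (z0 + r *: (x - z0)).
  by apply: homothety_interior => //; exact: ltW.
set xr := z0 + _.
move=> _ [z Kz <-] [theta t] [/= thetaS Ht]; rewrite /halfspace/= leNgt.
apply/negP => lt_t.
pose D := K `&` [set y | dotp y theta <= dotp x theta].
have mD : vol_measurable D.
  by apply: vol_measurableI => //; apply: closed_vol_measurable;
    exact: closed_halfspace_le.
pose a := rho * r.
have a0 : 0 < a by exact: mulr_gt0.
pose b := (1 - rho) *: z + (rho * (1 - r)) *: z0.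
pose C := [set u | D (a^-1 *: u - a^-1 *: b)].
have mC : vol_measurable C by exact: vol_measurable_affine.
have CE u : C u -> exists2 w, D w & u = a *: w + b.
  move=> Cu; exists (a^-1 *: u - a^-1 *: b) => //.
  by rewrite scalerBr !scalerA divff ?gt_eqF// !scale1r subrK.
have mH : vol_measurable (halfspace theta t `&` K).
  by apply: vol_measurableI => //; apply: closed_vol_measurable;
    exact: closed_halfspace.
(* [C] is the image of [D] under the homothety of center [z0] and ratio [r]
   followed by the one of center [z] and ratio [rho]. *)
have KC : C `<=` K.
  move=> u /CE[w [Kw _] ->].
  have Kw' := convex_comb convK (ltW r0) (ltW r1) Kw (interior_subset z0K).
  have := convex_comb convK (ltW rho0) _ Kw' Kz.
  rewrite /a /b (_ : _ + _ *: z = (rho * r) *: w +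
      ((1 - rho) *: z + (rho * (1 - r)) *: z0)); last first.
    by apply/rowP => i; rewrite !mxE; ring.
  by apply; rewrite /rho gerBl invr_ge0 ltW.
(* The map w -> a w + b sends [x] to the point assumed outside the half-space, and points of [D] are
   no further than [x] in direction [theta]. *)
have CH : C `&` (halfspace theta t `&` K) = set0.
  apply/seteqP; split => // u [/CE[w [_ /= wx] ->] [+ _]].
  rewrite /halfspace/= leNgt => /negP; apply; apply: le_lt_trans lt_t.
  rewrite /xr /a /b !(dotpDl, dotpZl, dotpNl).
  have : 0 <= rho * r * (dotp x theta - dotp w theta).
    by rewrite mulr_ge0 ?subr_ge0// ltW.
  by rewrite /rho; lra.
have CHK : (vol C + vol (halfspace theta t `&` K) <= vol K)%E.
  rewrite -volU//; apply: le_vol => //; first exact: measurableU mC mH.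
  by move=> u [/KC|[]].
(* [C] has volume a^d vol D, and a r = rho r^2 >= 4s by the choice of [r]. *)
have volC : (((4 * s) ^+ d * (v / 2 ^+ d.+1))%:E < vol C)%E.
  have ai0 : a^-1 != 0 by rewrite invr_eq0 gt_eqF.
  have := vol_affine (- (a^-1 *: b)) ai0 mD.
  rewrite -/C gtr0_norm ?invr_gt0// => /(congr1 (fun e => (a ^+ d)%:E * e)%E).
  rewrite muleA -EFinM -exprMn divff ?gt_eqF// expr1n mul1e => ->.
  apply: (@le_lt_trans _ _ ((a ^+ d)%:E * (r ^+ d * v / 2 ^+ d.+1)%:E)%E).
    rewrite -EFinM lee_fin -[r ^+ d * v / _]mulrA [leRHS]mulrA -exprMn ler_pM2r.
      by rewrite lerXn2r ?nnegrE//; [lra|rewrite /a; nra|rewrite /a; lra].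
    by rewrite divr_gt0// exprn_gt0.
  rewrite lte_pmul2l//; first exact: deepx.
  by rewrite lte_fin exprn_gt0.
have : (vol C <= (s ^+ d * v)%:E)%E.
  have fC : vol C \is a fin_num.
    have C0 : (0 <= vol C)%E by exact: measure_ge0.
    by rewrite ge0_fin_numE// (le_lt_trans (le_vol mC mK KC))// Kv ltry.
  have := le_trans (leeD2l (vol C) Ht) CHK.
  by rewrite Kv -(fineK fC) -!EFinM -EFinD !lee_fin; lra.
(* Here (4s)^d / 2^(d+1) = 2^(d-1) s^d, which is at least s^d because d >= 1. *)
rewrite leNgt => /negP; apply; apply: le_lt_trans volC.
rewrite lee_fin exprMn mulrAC -[leLHS]mul1r.
rewrite [leRHS](_ : _ = 4 ^+ d / 2 ^+ d.+1 * (s ^+ d * v)); last by ring.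
rewrite ler_wpM2r//; first by rewrite mulr_ge0 ?exprn_ge0// ltW.
rewrite ler_pdivlMr ?exprn_gt0// mul1r (_ : 4 = 2 ^+ 2)//; last by ring.
by rewrite -exprM ler_weXn2l// ?ler1n// mulSn mul1n -addn1 addnC leq_add2r.
Qed.

(** Suited to ratios that are only produced strictly above the bound, as in
    [floating_body_homothety]. *)
Lemma ereal_inf_above (S : set R) (c : R) : (forall l, c < l -> S l) ->
  (ereal_inf [set l%:E | l in S] <= c%:E)%E.
Proof.
move=> cS; apply/lee_addgt0Pr => e e0.
by apply: ereal_inf_lbound; exists (c + e) => //; apply: cS; rewrite ltrDl.
Qed.

End floating.

(** * Non-emptiness and the two distance bounds *)

Unset Implicit Arguments.

Theorem theorem2 (R : realType) (d : nat) (K : set 'rV[R]_d) (delta : R) :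
  (0 < d)%N -> convex_body K -> 0 < delta -> delta <= 8 ^- d ->
  [/\ floating_body K delta !=set0,
      (log_hausdorff_dist K (floating_body K delta)
        <= (1 + 8 * delta `^ d%:R^-1)%:E)%E
    & (banach_mazur_dist K (floating_body K delta)
        <= (1 + 24 * delta `^ d%:R^-1)%:E)%E].
Proof.
move=> d0 bK delta0 delta8.
set s := delta `^ d%:R^-1.
have s0 : 0 < s by exact: powR_gt0.
have sd : s ^+ d = delta.
  rewrite -powR_mulrn ?(ltW s0)// /s -powRrM mulVf ?pnatr_eq0 -?lt0n//.
  by rewrite powRr1// ltW.
have s8 : s <= 8^-1.
  by rewrite -(@ler_pXn2r _ d) ?nnegrE ?(ltW s0) ?invr_ge0 ?sd ?exprVn//.
have KdK : floating_body K delta `<=` K.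
  by apply: floating_body_sub => //; exact: ltW.
have good l : 1 + 8 * s < l -> exists x, [/\ K° x,
    homothety x l^-1 K `<=` floating_body K delta & 1 < l].
  move=> sl; have [x Kx] := floating_body_homothety d0 bK s0 s8 sl.
  by rewrite sd; exists x; split => //; lra.
have homK x l : 0 < l -> K x -> homothety x l^-1 K x.
  by move=> l0 Kx; exists x => //; rewrite subrr scaler0 add0r.
split.
(* Any ratio above [1 + 8 * s] would do: the centre of the homothety lies in the contracted copy. *)
- have [|x [Kx xK l1]] := good (2 + 8 * s); first by lra.
  by exists x; apply/xK/homK; [lra|exact: interior_subset].
- apply: ereal_inf_above => l sl; have [x [Kx xK l1]] := good l sl.
  have l0 : 0 < l by lra.
  split; first exact: ltW.
  exists x; split => //.
    rewrite interiorI; split => //.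
    (* The contraction takes a ball about [x] inside [K] to a ball about [x] inside the floating
       body. *)
    move: Kx => /nbhs_ballP[e /= e0 eK].
    apply/nbhs_ballP; exists (l^-1 * e) => /=; first by rewrite mulr_gt0 ?invr_gt0.
    move=> y; rewrite mx_norm_ball /ball_/= => xy; apply: xK.
    exists (x + l *: (y - x)).
      apply: eK; rewrite mx_norm_ball /ball_/= opprD addrA subrr add0r normrN.
      by rewrite mx_normZ gtr0_norm// distrC -ltr_pdivlMl.
    by rewrite (addrC x) addrK scalerA mulVf ?gt_eqF// scale1r subrK.
  move=> y /KdK Ky; have Kx' := interior_subset Kx.
  exists (l^-1 *: y + (1 - l^-1) *: x).
    by apply: convex_comb; [case: bK|rewrite invr_ge0 ltW|rewrite invf_le1 ?ltW| |].
  by apply/rowP => i; rewrite !mxE; field; rewrite gt_eqF.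
- apply: (@le_trans _ _ (1 + 8 * s)%:E); last by rewrite lee_fin; lra.
  apply: ereal_inf_above => l sl; have [x [Kx xK l1]] := good l sl.
  have l0 : 0 < l by lra.
  split; first exact: ltW.
  (* The transformation is the expansion that undoes the contraction, so [K] lies in the image of
     the floating body; the other inclusion is the image of [KdK]. *)
  exists x, (fun y => l *: (y - x) + x); split.
  - exists l%:M, (x - l *: x); split => [|y].
      by rewrite unitmxE det_scalar unitfE expf_neq0// gt_eqF.
    by rewrite mul_mx_scalar; apply/rowP => i; rewrite !mxE; ring.
  - move=> y Ky; exists (l^-1 *: (y - x) + x); first by apply: xK; exists y.
    by rewrite addrK scalerA divff ?gt_eqF// scale1r subrK.
  - by move=> _ [y /KdK Ky <-]; exists y.
Qed.
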